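(* For every positive integer $n$, $$4\sum_{m<n}\widetilde{\sigma}(m)\widetilde{\sigma}(n-m)=-\widetilde{\sigma}_3(n)+(2n-1)\widetilde{\sigma}(n),$$ $$24\sum_{m<n}\widehat{\sigma}(m)\widetilde{\sigma}(n-m)=-2\widetilde{\sigma}_3(n)+(6n-3)\widehat{\sigma}(n)-\widetilde{\sigma}(n),$$ $$16\sum_{m<n}\big(\widetilde{\sigma}(m)-3\widehat{\sigma}(m)\big)\widetilde{\sigma}_3(n-m)=2n\widetilde{\sigma}_3(n)+\widetilde{\sigma}(n)-3\widehat{\sigma}(n),$$ where the sums run over positive integers $m<n$.
   Context: For $s,n\in\mathbb{N}$ (positive integers), $\widetilde{\sigma}_s(n)=\sum_{d\mid n}(-1)^{d-1}d^s$ and $\widehat{\sigma}_s(n)=\sum_{d\mid n}(-1)^{\frac nd-1}d^s$; write $\widetilde{\sigma}=\widetilde{\sigma}_1$, $\widehat{\sigma}=\widehat{\sigma}_1$. *)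

(* Defs.v *)
From mathcomp Require Import all_boot all_order all_algebra.

Set Implicit Arguments.
Unset Strict Implicit.
Unset Printing Implicit Defensive.

Import Order.TTheory GRing.Theory Num.Theory.
Local Open Scope ring_scope.

(* Both functions are meant for s, n > 0. The exponents d - 1 and n/d - 1 are
   natural numbers there, since every divisor d of n satisfies 1 <= d <= n. *)

Definition sigma_tilde (s n : nat) : int :=
  \sum_(d <- divisors n) (-1) ^+ d.-1 * d%:Z ^+ s.

Definition sigma_hat (s n : nat) : int :=
  \sum_(d <- divisors n) (-1) ^+ (n %/ d)%N.-1 * d%:Z ^+ s.

(* Main.v *)
Require Import Defs.
From mathcomp Require Import all_boot all_order all_algebra.
From mathcomp Require Import ring zify.

Import Order.TTheory GRing.Theory Num.Theory.
Local Open Scope ring_scope.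

(** The whole theorem comes from one elementary identity of Liouville
    ([liouville]), which evaluates, for any function [f] on the naturals,
    the sum of [f |a - b| - f (a + b)] over the solutions of [a x + b y = n]
    in positive integers, as a sum over the divisors of [n].  For
    [f k = e^k k^2] with [e = 1] or [e = -1] the summand is
    [-4 (e^a a) (e^b b)], so that the left-hand side is a convolution of
    divisor functions; [f k = e^k k^4] gives convolutions of weights 1 and 3
    in the same way.  This yields
<<
      12 sigma_1 * sigma_1   = 5 sigma_3 + (1 - 6 n) sigma_1,
     240 sigma_1 * sigma_3   = 21 sigma_5 + (10 - 30 n) sigma_3 - sigma_1,
       4 tilde_1 * tilde_1   = - tilde_3 + (2 n - 1) tilde_1,
      16 tilde_1 * tilde_3   = (2 n - 2) tilde_3 - tilde_5 + tilde_1,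
>>
    the third of which is already the first claim.

    For the other two claims, pass to generating series and write
    [S_s = sum_n sigma_s(n) X^n], [U_s = S_s(X^2)] and [D = X d/dX].  Then the
    tilde series are [S_s - 2^(s+1) U_s] and the hat series is
    [H = S_1 - 2 U_1].  The first two identities hold for the [S_s] and,
    after [X -> X^2], for the [U_s]; comparing with the third one expresses the
    mixed product [S_1 U_1] linearly in the [S_s], [U_s] and their
    derivatives.  So every product of two weight-2 series is known, which
    settles [H tilde_1] (the second claim, [vanish_hat_tilde1]) and shows that
    [12 H^2 + H = S_3 + 4 U_3] ([vanish_hat_hat]).

    For the third claim one needs [H tilde_3].  Two independent linear relations
    between [H S_3] and [H U_3] are available: applying [D] to the formula for
    [H^2], where [D H] is given by the second claim, evaluates
    [H (S_3 - 4 U_3)] ([vanish_hat_weight4]), and the fourth identity above,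
    once [S_1 S_3] and [U_1 U_3] are eliminated, evaluates [H (S_3 - 8 U_3)].
    A combination of the two gives [48 H tilde_3 = 3 H - 2 tilde_3 - tilde_5]
    ([vanish_hat_tilde3]); subtracting this from the fourth identity makes
    [tilde_5] disappear.

    Since only the coefficients up to [n] matter, power series are replaced by
    polynomials modulo [X^N]. *)

(** * Sums over the solutions of a x + b y = n *)

Lemma big_bij_seq {R : nmodType} {I J : eqType} {s : seq I} {t : seq J}
    (h : I -> J) (g : J -> I) {F : I -> R} {G : J -> R} :
  uniq s -> uniq t ->
  (forall i, i \in s -> [/\ h i \in t, g (h i) = i & F i = G (h i)]) ->
  (forall j, j \in t -> g j \in s /\ h (g j) = j) ->
  \sum_(i <- s) F i = \sum_(j <- t) G j.
Proof.
move=> us ut hs ht.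
have hst : perm_eq (map h s) t.
  apply: uniq_perm => //.
    rewrite map_inj_in_uniq // => x y /hs[_ gx _] /hs[_ gy _] e.
    by rewrite -gx -gy e.
  move=> j; apply/mapP/idP => [[i /hs[ti _ _] ->] //|/ht[gj e]].
  by exists (g j).
rewrite -(perm_big _ hst) /= big_map [LHS]big_seq [RHS]big_seq.
by apply: eq_bigr => i /hs[].
Qed.

(** The quadruples [((a, x), (b, y))] of positive integers with
    [a x + b y = n], listed so that a sum over them unfolds into a convolution
    of two divisor sums; [mem_quads] is the symmetric description. *)
Definition quads (n : nat) : seq ((nat * nat) * (nat * nat)) :=
  [seq ((p.1, m %/ p.1), (p.2, (n - m) %/ p.2))%N |
     m <- index_iota 1 n,
     p <- [seq (a, b) | a <- divisors m, b <- divisors (n - m)]].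

Lemma mem_quads n a x b y :
  (((a, x), (b, y)) \in quads n) =
  [&& 0 < a, 0 < x, 0 < b, 0 < y & a * x + b * y == n]%N.
Proof.
apply/allpairsPdep/idP => [[m [p [hm hp]]]|].
  move: hm; rewrite mem_index_iota => /andP[m0 mn].
  case/allpairsP: hp => -[c d] /= [].
  have nm0 : (0 < n - m)%N by rewrite subn_gt0.
  rewrite -!dvdn_divisors // => hc hd -> /= [-> -> -> ->].
  have c0 := dvdn_gt0 m0 hc; have d0 := dvdn_gt0 nm0 hd.
  rewrite !divn_gt0 // (dvdn_leq m0 hc) (dvdn_leq nm0 hd) c0 d0 /=.
  by rewrite ![(_ * (_ %/ _))%N]mulnC !divnK // subnKC // ltnW.
case/and5P=> a0 x0 b0 y0 /eqP e.
have ax0 : (0 < a * x)%N by rewrite muln_gt0 a0.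
have by0 : (0 < b * y)%N by rewrite muln_gt0 b0.
have enm : (n - a * x = b * y)%N by rewrite -e addKn.
exists (a * x)%N, (a, b); split => /=.
- by rewrite mem_index_iota ax0 -e -addn1 leq_add2l.
- apply/allpairsP; exists (a, b); split => //=.
    by rewrite -dvdn_divisors // dvdn_mulr.
  by rewrite enm -dvdn_divisors // dvdn_mulr.
- by rewrite enm !mulKn.
Qed.

Lemma uniq_quads n : uniq (quads n).
Proof.
apply: allpairs_uniq_dep => [|m _|[m p] [m' p']]; first exact: iota_uniq.
  apply: allpairs_uniq; rewrite ?divisors_uniq //.
  by move=> [? ?] [? ?] _ _ /= [-> ->].
case/allpairsPdep=> m1 [p1 [hm hp [-> ->]]].
case/allpairsPdep=> m2 [p2 [hm' hp' [-> ->]]] /=.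
move: hm hm'; rewrite !mem_index_iota => /andP[m10 _] /andP[m20 _].
case/allpairsP: hp => -[a b] /= [ha _ ->].
case/allpairsP: hp' => -[a' b'] /= [ha' _ ->] /=.
move: ha ha'; rewrite -!dvdn_divisors // => ha ha' [ea ex eb _]; subst.
by rewrite -(divnK ha) ex divnK.
Qed.

Lemma sum_quads_conv n (g h : nat -> int) :
  \sum_(1 <= m < n)
     (\sum_(a <- divisors m) g a) * (\sum_(b <- divisors (n - m)) h b)
  = \sum_(u <- quads n) g u.1.1 * h u.2.1.
Proof.
rewrite /quads big_allpairs_dep; apply: eq_bigr => m _ /=.
rewrite big_allpairs big_distrl /=; apply: eq_bigr => a _.
by rewrite big_distrr.
Qed.

Lemma sum_quads_swap n (P : pred ((nat * nat) * (nat * nat))) F :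
  \sum_(u <- quads n | P u) F u
  = \sum_(u <- quads n | P (u.2, u.1)) F (u.2, u.1) :> int.
Proof.
rewrite -!(big_filter (quads n)).
apply: (big_bij_seq (fun u => (u.2, u.1)) (fun u => (u.2, u.1)));
  rewrite ?filter_uniq ?uniq_quads //.
all: move=> [[a x] [b y]]; rewrite !mem_filter !mem_quads /= => /andP[-> h].
all: split=> //; move: h => /and5P[-> -> -> -> /eqP h].
all: by rewrite -h addnC; exact: eqxx.
Qed.

(** From [a x + b y = a (x + y) + (b - a) y]: the solutions with [a < b]
    correspond to those with [y < x].  This exchange of a condition on the
    divisors for a condition on the codivisors is what drives Liouville's
    identity. *)
Lemma sum_quads_shear n (F : nat -> nat -> nat -> nat -> int) :
  \sum_(u <- quads n | (u.1.1 < u.2.1)%N) F u.1.1 u.1.2 u.2.1 u.2.2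
  = \sum_(u <- quads n | (u.2.2 < u.1.2)%N)
      F u.1.1 (u.1.2 - u.2.2)%N (u.1.1 + u.2.1)%N u.2.2.
Proof.
rewrite -!(big_filter (quads n)).
apply: (big_bij_seq
  (fun u => ((u.1.1, (u.1.2 + u.2.2)%N), ((u.2.1 - u.1.1)%N, u.2.2)))
  (fun u => ((u.1.1, (u.1.2 - u.2.2)%N), ((u.1.1 + u.2.1)%N, u.2.2))));
  rewrite ?filter_uniq ?uniq_quads //.
  move=> [[a x] [b y]]; rewrite !mem_filter !mem_quads /=.
  move=> /andP[ab /and5P[a0 x0 b0 y0 /eqP e]]; split.
  - apply/andP; split; [lia|apply/and5P; split=> //; [lia|lia|apply/eqP]].
    by rewrite -e mulnDr mulnBl -addnA subnKC // leq_mul2r ltnW ?orbT.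
  - by rewrite addnK subnKC // ltnW.
  - by rewrite addnK subnKC // ltnW.
move=> [[a x] [b y]]; rewrite !mem_filter !mem_quads /=.
move=> /andP[ab /and5P[a0 x0 b0 y0 /eqP e]]; split.
  apply/andP; split; [lia|apply/and5P; split=> //; [lia|lia|apply/eqP]].
  by rewrite -e mulnBr mulnDl addnA subnK // leq_mul2l ltnW ?orbT.
by rewrite subnK ?addKn // ltnW.
Qed.

(** If [a = b = d] then [d (x + y) = n], so [d] divides [n] and [x + y = n / d]
    has [n / d - 1] solutions. *)
Lemma sum_quads_eq_divisor n (G : nat -> int) : (0 < n)%N ->
  \sum_(u <- quads n | u.1.1 == u.2.1) G u.2.1
  = \sum_(d <- divisors n) ((n %/ d)%:Z - 1) * G d.
Proof.
move=> n0; transitivity (\sum_(p <- [seq (d, c) | d <- divisors n,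
    c <- index_iota 1 (n %/ d)]) G p.1); last first.
  rewrite big_allpairs_dep /= [LHS]big_seq [RHS]big_seq; apply: eq_bigr => d.
  rewrite -dvdn_divisors // => dn.
  have q0 : (0 < n %/ d)%N.
    by rewrite divn_gt0 ?(dvdn_gt0 n0 dn) // (dvdn_leq n0 dn).
  by rewrite big_const_nat iter_addr_0 -mulr_natl natz -subzn.
rewrite -big_filter.
apply: (big_bij_seq (fun u => (u.2.1, u.2.2))
   (fun p => ((p.1, (n %/ p.1 - p.2)%N), (p.1, p.2)))).
- by rewrite filter_uniq ?uniq_quads.
- apply: allpairs_uniq_dep => [|m _|[? ?] [? ?] _ _ /= [-> ->]] //.
  + exact: divisors_uniq.
  + exact: iota_uniq.
- move=> [[a x] [b y]]; rewrite mem_filter mem_quads /=.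
  case/andP=> /eqP -> /and5P[_ x0 b0 y0 /eqP e].
  have eq : (n %/ b = x + y)%N by rewrite -e -mulnDr mulKn.
  split=> //; last by rewrite eq addnK.
  apply/allpairsPdep; exists b, y; split=> //.
    by rewrite -dvdn_divisors // -e -mulnDr dvdn_mulr.
  by rewrite mem_index_iota eq; lia.
- move=> [d c] /allpairsPdep[d' [c' [+ + [-> ->]]]] /=.
  rewrite -dvdn_divisors // mem_index_iota => dn hc; split=> //.
  rewrite mem_filter mem_quads /= eqxx /=.
  have d0 := dvdn_gt0 n0 dn.
  have -> : (d' * (n %/ d' - c') + d' * c' = n)%N.
    by rewrite -mulnDr subnK 1?mulnC ?divnK //; lia.
  by rewrite eqxx; lia.
Qed.

(** If [x = y] then [(a + b) x = n], so [d = a + b] divides [n] and [b] is any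
    number with [0 < b < d]. *)
Lemma sum_quads_eq_codivisor n (G : nat -> nat -> int) : (0 < n)%N ->
  \sum_(u <- quads n | u.1.2 == u.2.2) G (u.1.1 + u.2.1)%N u.2.1
  = \sum_(d <- divisors n) \sum_(1 <= c < d) G d c.
Proof.
move=> n0; transitivity (\sum_(p <- [seq (d, c) | d <- divisors n,
    c <- index_iota 1 d]) G p.1 p.2); last by rewrite big_allpairs_dep.
rewrite -big_filter.
apply: (big_bij_seq (fun u => ((u.1.1 + u.2.1)%N, u.2.1))
   (fun p => (((p.1 - p.2)%N, (n %/ p.1)%N), (p.2, (n %/ p.1)%N)))).
- by rewrite filter_uniq ?uniq_quads.
- apply: allpairs_uniq_dep => [|m _|[? ?] [? ?] _ _ /= [-> ->]] //.
  + exact: divisors_uniq.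
  + exact: iota_uniq.
- move=> [[a x] [b y]]; rewrite mem_filter mem_quads /=.
  case/andP=> /eqP -> /and5P[a0 x0 b0 y0 /eqP e].
  have eq : (n %/ (a + b) = y)%N by rewrite -e -mulnDl mulKn // addn_gt0 a0.
  split=> //; last by rewrite eq addnK.
  apply/allpairsPdep; exists (a + b)%N, b; split=> //.
    by rewrite -dvdn_divisors // -e -mulnDl dvdn_mulr.
  by rewrite mem_index_iota; lia.
- move=> [d c] /allpairsPdep[d' [c' [+ + [-> ->]]]] /=.
  rewrite -dvdn_divisors // mem_index_iota => dn hc; split; last first.
    by rewrite subnK //; lia.
  rewrite mem_filter mem_quads /= eqxx /=.
  have d0 := dvdn_gt0 n0 dn.
  have q0 : (0 < n %/ d')%N by rewrite divn_gt0 // (dvdn_leq n0 dn).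
  have -> : ((d' - c') * (n %/ d') + c' * (n %/ d') = n)%N.
    by rewrite -mulnDl subnK 1?mulnC ?divnK //; lia.
  by rewrite eqxx; lia.
Qed.

Lemma sum_trichotomy {I : eqType} (s : seq I) (v w : I -> nat) (F : I -> int) :
  \sum_(u <- s) F u
  = \sum_(u <- s | (v u < w u)%N) F u + \sum_(u <- s | (w u < v u)%N) F u
    + \sum_(u <- s | v u == w u) F u.
Proof.
rewrite [X in X + _ + _]big_mkcond [X in _ + X + _]big_mkcond.
rewrite [X in _ + _ + X]big_mkcond -!big_split /=; apply: eq_bigr => u _.
by case: ltngtP; rewrite ?addr0 ?add0r.
Qed.

(** Liouville's identity.  Shearing turns the sum of [f |a - b|] over [a <> b]
    into twice the sum of [f b] over [y < x], and the sum of [f (a + b)] over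
    [x <> y] into twice the sum of [f b] over [a < b].  The difference of these
    two sums of [f b] is obtained by splitting the sum of [f b] over all
    solutions in two ways, by comparing [a] with [b] and by comparing [x] with
    [y]: shearing also identifies its parts over [b < a] and over [x < y], and
    only the diagonal terms [a = b] and [x = y] survive. *)
Theorem liouville n (f : nat -> int) : (0 < n)%N ->
  \sum_(u <- quads n) (f `|u.1.1 - u.2.1|%N - f (u.1.1 + u.2.1)%N)
  = \sum_(d <- divisors n) (((n %/ d)%:Z - 1) * (f 0%N + 2 * f d)
      - \sum_(1 <= c < d) (f d + 2 * f c)).
Proof.
move=> n0.
have lt_diff : \sum_(u <- quads n | (u.1.1 < u.2.1)%N) f `|u.1.1 - u.2.1|%N
    = \sum_(u <- quads n | (u.2.2 < u.1.2)%N) f u.2.1.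
  rewrite (sum_quads_shear n (fun a _ b _ => f `|a - b|%N)).
  by apply: eq_bigr => -[[a x] [b y]] _ /=; congr f; lia.
have gt_diff : \sum_(u <- quads n | (u.2.1 < u.1.1)%N) f `|u.1.1 - u.2.1|%N
    = \sum_(u <- quads n | (u.2.2 < u.1.2)%N) f u.2.1.
  rewrite sum_quads_swap -lt_diff /=.
  by apply: eq_bigr => -[[a x] [b y]] _ /=; congr f; lia.
have gt_sum : \sum_(u <- quads n | (u.2.2 < u.1.2)%N) f (u.1.1 + u.2.1)%N
    = \sum_(u <- quads n | (u.1.1 < u.2.1)%N) f u.2.1.
  by rewrite (sum_quads_shear n (fun _ _ b _ => f b)).
have lt_sum : \sum_(u <- quads n | (u.1.2 < u.2.2)%N) f (u.1.1 + u.2.1)%N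
    = \sum_(u <- quads n | (u.1.1 < u.2.1)%N) f u.2.1.
  rewrite sum_quads_swap -gt_sum /=.
  by apply: eq_bigr => -[[a x] [b y]] _ /=; rewrite addnC.
have dual : \sum_(u <- quads n | (u.2.1 < u.1.1)%N) f u.2.1
    = \sum_(u <- quads n | (u.1.2 < u.2.2)%N) f u.2.1.
  rewrite sum_quads_swap /= (sum_quads_shear n (fun a _ _ _ => f a)).
  by rewrite [RHS]sum_quads_swap.
have := sum_trichotomy (quads n) (fun u => u.1.1) (fun u => u.2.1)
          (fun u => f u.2.1).
rewrite (sum_trichotomy (quads n) (fun u => u.1.2) (fun u => u.2.2)
          (fun u => f u.2.1)).
rewrite dual => twoways.
rewrite !sumrB -(sum_quads_eq_divisor n (fun d => f 0%N + 2 * f d)) //.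
rewrite -(sum_quads_eq_codivisor n (fun d c => f d + 2 * f c)) //.
rewrite !big_split /= -!mulr_sumr.
rewrite (sum_trichotomy (quads n) (fun u => u.1.1) (fun u => u.2.1)).
rewrite (sum_trichotomy (quads n) (fun u => u.1.2) (fun u => u.2.2)
          (fun u => f (u.1.1 + _)%N)).
rewrite lt_diff gt_diff gt_sum lt_sum.
have -> : \sum_(u <- quads n | u.1.1 == u.2.1) f `|u.1.1 - u.2.1|%N
   = \sum_(u <- quads n | u.1.1 == u.2.1) f 0%N.
  by apply: eq_bigr => u /eqP ->; rewrite distnn.
move: twoways.
move: (\sum_(u <- _ | (u.1.2 < _)%N) _) (\sum_(u <- _ | (u.2.2 < _)%N) _) => A B.
move: (\sum_(u <- _ | (u.1.1 < _)%N) _) => C.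
move: (\sum_(u <- _ | u.1.2 == _) f u.2.1).
move: (\sum_(u <- _ | u.1.1 == _) f u.2.1) => E F.
move: (\sum_(u <- _ | u.1.2 == _) _) (\sum_(u <- _ | u.1.1 == _) _) => G H.
by lia.
Qed.

(** * Convolutions of divisor functions *)

Definition sigma (s n : nat) : int := \sum_(d <- divisors n) d%:Z ^+ s.

Lemma sum_quads_sym n (g h : nat -> int) :
  \sum_(u <- quads n) (g u.1.1 * h u.2.1 + h u.1.1 * g u.2.1)
  = 2 * \sum_(u <- quads n) g u.1.1 * h u.2.1.
Proof.
rewrite big_split /= [X in _ + X]sum_quads_swap /=.
under [X in _ + X]eq_bigr do rewrite mulrC.
by rewrite mulr_natl mulr2n.
Qed.

Lemma divisor_gt0 {n d} : (0 < n)%N -> d \in divisors n -> (0 < d)%N.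
Proof. by move=> n0; rewrite -dvdn_divisors // => /(dvdn_gt0 n0). Qed.

Lemma divisor_mul {n d} : (0 < n)%N -> d \in divisors n ->
  (n %/ d)%:Z * d%:Z = n%:Z.
Proof. by move=> n0; rewrite -dvdn_divisors // -PoszM => /divnK ->. Qed.

Lemma sum_const_below (c : int) d : (0 < d)%N ->
  \sum_(1 <= i < d) c = (d%:Z - 1) * c.
Proof.
by move=> d0; rewrite big_const_nat iter_addr_0 -mulr_natl natz -subzn.
Qed.

Lemma telescope_below {f : nat -> int} (F : nat -> int) d : F 1%N = 0 ->
  (forall k, F k.+2 = F k.+1 + f k.+1) ->
  (0 < d)%N -> \sum_(1 <= c < d) f c = F d.
Proof.
move=> F1 FS; case: d => // d _; elim: d => [|d IH].
  by rewrite big_geq.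
by rewrite big_nat_recr //= IH FS.
Qed.

Lemma sign_distn (a b : nat) :
  (-1) ^+ `|a - b|%N = (-1) ^+ a * (-1) ^+ b :> int.
Proof.
wlog ab : a b / (a <= b)%N => [hw|].
  by case/orP: (leq_total a b) => /hw //; rewrite distnC mulrC.
rewrite distnEr // -[in RHS](subnKC ab) exprD mulrA -exprD addnn -mul2n.
by rewrite exprM sqrrN !expr1n mul1r.
Qed.

Lemma distn_sqr (a b : nat) : `|a - b|%N%:Z ^+ 2 = (a%:Z - b%:Z) ^+ 2.
Proof. by rewrite abszE real_normK // num_real. Qed.

Lemma distn_pow4 (a b : nat) : `|a - b|%N%:Z ^+ 4 = (a%:Z - b%:Z) ^+ 4.
Proof. by rewrite !(exprM _ 2 2) distn_sqr. Qed.

(** Used with a known equation between sums: what is left is a polynomial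
    identity in these sums, which [ring] decides. *)
Lemma eq_from_multiple (c : int) {u v x y : int} :
  u = v -> x - y = c * (u - v) -> x = y.
Proof. by move=> ->; rewrite subrr mulr0 => /subr0_eq. Qed.

(** Liouville's identity for [f k = k^2]. *)
Lemma conv_sigma1_sigma1 n : (0 < n)%N ->
  12 * (\sum_(1 <= m < n) sigma 1 m * sigma 1 (n - m))
  = 5 * sigma 3 n + (1 - 6 * n%:Z) * sigma 1 n.
Proof.
move=> n0; rewrite sum_quads_conv.
have := liouville n (fun k => k%:Z ^+ 2) n0.
rewrite (eq_bigr (fun u => - 4 * (u.1.1%:Z ^+ 1 * u.2.1%:Z ^+ 1))); last first.
  by move=> u _; rewrite distn_sqr PoszD; ring.
rewrite -mulr_sumr.
set S := \sum_(u <- _) _; set T := \sum_(d <- _) _ => L.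
suff : 3 * T = - (5 * sigma 3 n + (1 - 6 * n%:Z) * sigma 1 n).
  by rewrite -L; clearbody S; lia.
rewrite /T /sigma !mulr_sumr -big_split -sumrN /= big_seq [RHS]big_seq.
apply: eq_bigr => d hd; rewrite -(divisor_mul n0 hd).
have d0 := divisor_gt0 n0 hd.
rewrite big_split /= sum_const_below // -mulr_sumr.
have : \sum_(1 <= c < d) 6 * c%:Z ^+ 2 = (d%:Z - 1) * d%:Z * (2 * d%:Z - 1).
  apply: (telescope_below (fun d => (d%:Z - 1) * d%:Z * (2 * d%:Z - 1))) => //.
  by move=> k; rewrite !intS; ring.
rewrite -mulr_sumr => E.
by apply: (eq_from_multiple (-1) E); ring.
Qed.

(** Liouville's identity for [f k = k^4]. *)
Lemma conv_sigma1_sigma3 n : (0 < n)%N ->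
  240 * (\sum_(1 <= m < n) sigma 1 m * sigma 3 (n - m))
  = 21 * sigma 5 n + (10 - 30 * n%:Z) * sigma 3 n - sigma 1 n.
Proof.
move=> n0; rewrite sum_quads_conv.
have := liouville n (fun k => k%:Z ^+ 4) n0.
rewrite (eq_bigr (fun u => - 8 * (u.1.1%:Z ^+ 1 * u.2.1%:Z ^+ 3 +
    u.1.1%:Z ^+ 3 * u.2.1%:Z ^+ 1))); last first.
  by move=> u _; rewrite distn_pow4 PoszD; ring.
rewrite -mulr_sumr (sum_quads_sym n (fun a => a%:Z ^+ 1) (fun a => a%:Z ^+ 3)).
set S := \sum_(u <- _) _; set T := \sum_(d <- _) _ => L.
suff : 15 * T = - (21 * sigma 5 n + (10 - 30 * n%:Z) * sigma 3 n - sigma 1 n).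
  by rewrite -L; clearbody S; lia.
rewrite /T /sigma !mulr_sumr -sumrN -!big_split -sumrN /=.
rewrite big_seq [RHS]big_seq.
apply: eq_bigr => d hd; rewrite -(divisor_mul n0 hd).
have d0 := divisor_gt0 n0 hd.
rewrite big_split /= sum_const_below // -mulr_sumr.
have : \sum_(1 <= c < d) 30 * c%:Z ^+ 4 =
    d%:Z * (d%:Z - 1) * (2 * d%:Z - 1) * (3 * d%:Z ^+ 2 - 3 * d%:Z - 1).
  apply: (telescope_below (fun d =>
     d%:Z * (d%:Z - 1) * (2 * d%:Z - 1) * (3 * d%:Z ^+ 2 - 3 * d%:Z - 1))) => //.
  by move=> k; rewrite !intS; ring.
rewrite -mulr_sumr => E.
by apply: (eq_from_multiple (-1) E); ring.
Qed.

(** Liouville's identity for [f k = (-1)^k k^2]: the sign of [a - b] and of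
    [a + b] is [(-1)^a (-1)^b], so it factors out of the summand. *)
Lemma conv_tilde1_tilde1 n : (0 < n)%N ->
  4 * (\sum_(1 <= m < n) sigma_tilde 1 m * sigma_tilde 1 (n - m))
  = - sigma_tilde 3 n + (2 * n%:Z - 1) * sigma_tilde 1 n.
Proof.
move=> n0; rewrite sum_quads_conv.
have := liouville n (fun k => (-1) ^+ k * k%:Z ^+ 2) n0.
rewrite big_seq (eq_bigr (fun u => - 4 * (((-1) ^+ u.1.1.-1 * u.1.1%:Z ^+ 1)
   * ((-1) ^+ u.2.1.-1 * u.2.1%:Z ^+ 1)))); last first.
  move=> [[a x] [b y]]; rewrite mem_quads /= => /and5P[a0 _ b0 _ _].
  rewrite distn_sqr sign_distn PoszD exprD -(prednK a0) -(prednK b0) /= !exprS.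
  ring.
rewrite -big_seq -mulr_sumr.
set S := \sum_(u <- _) _; set T := \sum_(d <- _) _ => L.
suff : T = - (- sigma_tilde 3 n + (2 * n%:Z - 1) * sigma_tilde 1 n).
  by rewrite -L; clearbody S; lia.
rewrite /T /sigma_tilde !mulr_sumr -sumrN -!big_split -sumrN /=.
rewrite big_seq [RHS]big_seq.
apply: eq_bigr => d hd; rewrite -(divisor_mul n0 hd).
have d0 := divisor_gt0 n0 hd.
rewrite big_split /= sum_const_below // -mulr_sumr.
have : \sum_(1 <= c < d) 2 * ((-1) ^+ c * c%:Z ^+ 2)
     = (-1) ^+ d * (d%:Z - d%:Z ^+ 2).
  apply: (telescope_below (fun d => (-1) ^+ d * (d%:Z - d%:Z ^+ 2))) => //.
  by move=> k; rewrite !intS !exprS; ring.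
rewrite -mulr_sumr -(prednK d0) /= exprS => E.
by apply: (eq_from_multiple (-1) E); ring.
Qed.

(** Liouville's identity for [f k = (-1)^k k^4]. *)
Lemma conv_tilde1_tilde3 n : (0 < n)%N ->
  16 * (\sum_(1 <= m < n) sigma_tilde 1 m * sigma_tilde 3 (n - m))
  = (2 * n%:Z - 2) * sigma_tilde 3 n - sigma_tilde 5 n + sigma_tilde 1 n.
Proof.
move=> n0; rewrite sum_quads_conv.
have := liouville n (fun k => (-1) ^+ k * k%:Z ^+ 4) n0.
pose g s (a : nat) : int := (-1) ^+ a.-1 * a%:Z ^+ s.
rewrite big_seq (eq_bigr (fun u => - 8 * (g 1%N u.1.1 * g 3%N u.2.1
   + g 3%N u.1.1 * g 1%N u.2.1))); last first.
  move=> [[a x] [b y]]; rewrite mem_quads /= => /and5P[a0 _ b0 _ _].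
  rewrite /g distn_pow4 sign_distn PoszD exprD -(prednK a0) -(prednK b0) /=.
  rewrite !exprS; ring.
rewrite -big_seq -mulr_sumr sum_quads_sym /g.
set S := \sum_(u <- _) _; set T := \sum_(d <- _) _ => L.
suff : T = - ((2 * n%:Z - 2) * sigma_tilde 3 n - sigma_tilde 5 n
              + sigma_tilde 1 n).
  by rewrite -L; clearbody S; lia.
rewrite /T /sigma_tilde !mulr_sumr -sumrN -!big_split -sumrN /=.
rewrite big_seq [RHS]big_seq.
apply: eq_bigr => d hd; rewrite -(divisor_mul n0 hd).
have d0 := divisor_gt0 n0 hd.
rewrite big_split /= sum_const_below // -mulr_sumr.
have : \sum_(1 <= c < d) 2 * ((-1) ^+ c * c%:Z ^+ 4)
     = (-1) ^+ d * (2 * d%:Z ^+ 3 - d%:Z ^+ 4 - d%:Z).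
  apply: (telescope_below (fun d =>
     (-1) ^+ d * (2 * d%:Z ^+ 3 - d%:Z ^+ 4 - d%:Z))) => //.
  by move=> k; rewrite !intS !exprS; ring.
rewrite -mulr_sumr -(prednK d0) /= exprS => E.
by apply: (eq_from_multiple (-1) E); ring.
Qed.

(** * The alternating divisor functions in terms of sigma(n) and sigma(n/2) *)

Definition halved (a : nat -> int) (n : nat) : int :=
  if (2 %| n)%N then a (n %/ 2)%N else 0.

Lemma sum_even_divisors n (g : nat -> int) : (0 < n)%N ->
  \sum_(d <- divisors n | (2 %| d)%N) g d
  = halved (fun m => \sum_(d <- divisors m) g (2 * d)%N) n.
Proof.
move=> n0; rewrite /halved; case: ifP => [n2|n2]; last first.
  rewrite big_seq_cond big1 // => d /andP[]; rewrite -dvdn_divisors // => dn d2.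
  by rewrite (dvdn_trans d2 dn) in n2.
have m0 : (0 < n %/ 2)%N by rewrite divn_gt0 // dvdn_leq.
rewrite -big_filter; apply: (big_bij_seq (fun d => d %/ 2)%N (muln 2)).
- by rewrite filter_uniq // divisors_uniq.
- exact: divisors_uniq.
- move=> d; rewrite mem_filter -!dvdn_divisors // => /andP[d2 dn].
  by rewrite mulnC divnK // dvdn_divRL // divnK.
- move=> d; rewrite mem_filter -!dvdn_divisors // => dn.
  by rewrite dvdn_mulr // mulKn // mulnC -dvdn_divRL.
Qed.

Lemma sum_even_codivisors n (g : nat -> int) : (0 < n)%N ->
  \sum_(d <- divisors n | (2 %| n %/ d)%N) g d
  = halved (fun m => \sum_(d <- divisors m) g d) n.
Proof.
move=> n0; rewrite /halved; case: ifP => [n2|n2]; last first.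
  rewrite big_seq_cond big1 // => d /andP[]; rewrite -dvdn_divisors // => dn.
  by move=> /(dvdn_mulr d); rewrite divnK // n2.
have m0 : (0 < n %/ 2)%N by rewrite divn_gt0 // dvdn_leq.
rewrite -big_filter; apply: (big_bij_seq id id).
- by rewrite filter_uniq // divisors_uniq.
- exact: divisors_uniq.
- move=> d; rewrite mem_filter -!dvdn_divisors // => /andP[d2 dn].
  by rewrite dvdn_divRL // mulnC -dvdn_divRL.
- move=> d; rewrite mem_filter -!dvdn_divisors //.
  rewrite dvdn_divRL // => dn; split=> //.
  have dn' := dvdn_trans (dvdn_mulr 2 (dvdnn d)) dn.
  by rewrite dvdn_divRL // dn' mulnC dn.
Qed.

Lemma sign_pred d : (0 < d)%N -> (-1) ^+ d.-1 = 1 - 2 * (2 %| d)%N%:R :> int.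
Proof. by case: d => // d _; rewrite -signr_odd dvdn2 /= negbK; case: odd. Qed.

Lemma sum_sign_divisors n (P : pred nat) (g : nat -> int) :
  \sum_(d <- divisors n) (1 - 2 * (P d)%:R) * g d
  = \sum_(d <- divisors n) g d - 2 * \sum_(d <- divisors n | P d) g d.
Proof.
rewrite [X in _ - 2 * X]big_mkcond mulr_sumr -sumrB; apply: eq_bigr => d _.
by case: (P d) => /=; ring.
Qed.

Lemma sigma_tildeE s n : (0 < n)%N ->
  sigma_tilde s n = sigma s n - 2 ^+ s.+1 * halved (sigma s) n.
Proof.
move=> n0.
rewrite /sigma_tilde big_seq.
rewrite (eq_bigr (fun d => (1 - 2 * (2 %| d)%N%:R) * d%:Z ^+ s)); last first.
  by move=> d hd; rewrite sign_pred // (divisor_gt0 n0).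
rewrite -big_seq sum_sign_divisors sum_even_divisors // /halved.
congr (_ - _); case: ifP => _; last by rewrite !mulr0.
rewrite exprS -mulrA; congr (_ * _); rewrite mulr_sumr.
by apply: eq_bigr => d _; rewrite PoszM exprMn.
Qed.

Lemma sigma_hatE s n : (0 < n)%N ->
  sigma_hat s n = sigma s n - 2 * halved (sigma s) n.
Proof.
move=> n0.
rewrite /sigma_hat big_seq.
rewrite (eq_bigr (fun d => (1 - 2 * (2 %| n %/ d)%N%:R) * d%:Z ^+ s)); last first.
  move=> d hd; rewrite sign_pred //.
  have d0 := divisor_gt0 n0 hd.
  by rewrite divn_gt0 //; apply: dvdn_leq => //; rewrite dvdn_divisors.
by rewrite -big_seq sum_sign_divisors sum_even_codivisors.
Qed.

(** * Power series modulo X^N *)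

(** Membership in the ideal generated by [X^N]: congruences modulo this ideal
    are written with all terms on one side. *)
Definition vanish (N : nat) (p : {poly int}) := forall i, (i < N)%N -> p`_i = 0.

Lemma vanishD {N p q} : vanish N p -> vanish N q -> vanish N (p + q).
Proof. by move=> hp hq i iN; rewrite coefD hp ?hq ?addr0. Qed.

Lemma vanishM {N} p {q} : vanish N q -> vanish N (p * q).
Proof.
move=> hq i iN; rewrite coefM big1 // => j _.
by rewrite hq ?mulr0 // (leq_ltn_trans _ iN) // leq_subr.
Qed.

Lemma vanish_comp {N p} : vanish N p -> vanish N (p \Po 'X^2).
Proof.
move=> hp i iN; rewrite coef_comp_poly_Xn //; case: ifP => // _.
by rewrite hp // (leq_ltn_trans _ iN) // leq_div.
Qed.

Lemma coef_natl (k : nat) (p : {poly int}) i : (k%:R * p)`_i = k%:R * p`_i.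
Proof. by rewrite !mulr_natl coefMn. Qed.

Lemma vanish_cancel {N} k {p} : vanish N (k.+1%:R * p) -> vanish N p.
Proof.
move=> hp i iN; apply: (@mulfI _ k.+1%:R); first by rewrite pnatr_eq0.
by rewrite -coef_natl hp // mulr0.
Qed.

Definition theta (p : {poly int}) : {poly int} := 'X * p^`().

Lemma coef_theta p i : (theta p)`_i = i%:Z * p`_i.
Proof.
rewrite coefXM; case: i => [|i] /=; first by rewrite mul0r.
by rewrite coef_deriv -mulr_natl natz.
Qed.

(** Contrary to the plain derivative, [theta] loses no precision. *)
Lemma vanish_theta {N p} : vanish N p -> vanish N (theta p).
Proof. by move=> hp i iN; rewrite coef_theta hp // mulr0. Qed.

Lemma thetaD p q : theta (p + q) = theta p + theta q.
Proof. by rewrite /theta derivD mulrDr. Qed.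

Lemma thetaN p : theta (- p) = - theta p.
Proof. by rewrite /theta derivN mulrN. Qed.

Lemma thetaM p q : theta (p * q) = theta p * q + p * theta q.
Proof. by rewrite /theta derivM; ring. Qed.

Lemma theta_natl (k : nat) p : theta (k%:R * p) = k%:R * theta p.
Proof. by rewrite /theta !mulr_natl derivMn mulrnAr. Qed.

Lemma theta_comp p : theta (p \Po 'X^2) = 2 * (theta p \Po 'X^2).
Proof.
by rewrite /theta deriv_comp comp_polyM comp_polyX derivXn /= expr1 expr2; ring.
Qed.

Lemma comp_natl (k : nat) (p q : {poly int}) :
  (k%:R * p) \Po q = k%:R * (p \Po q).
Proof. by rewrite !mulr_natl raddfMn. Qed.

(** The constant term is forced to be [0], whatever [a 0] is: [divisors 0] is
    not empty, so that the divisor sums do not vanish at [0]. *)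
Definition represents N (p : {poly int}) (a : nat -> int) :=
  forall i, (i < N)%N -> p`_i = if i == 0%N then 0 else a i.

Lemma represents_comp {N p a} : represents N p a ->
  represents N (p \Po 'X^2) (halved a).
Proof.
move=> pa i iN; rewrite coef_comp_poly_Xn // /halved.
case: ifP => i2; last by case: eqP.
rewrite pa ?(leq_ltn_trans (leq_div _ _) iN) //.
case: (posnP i) => [->|i0]; first by rewrite div0n.
by rewrite gtn_eqF // divn_gt0 // dvdn_leq.
Qed.

Lemma coef_mul_conv (p q : {poly int}) i : p`_0 = 0 -> q`_0 = 0 ->
  (p * q)`_i = \sum_(1 <= m < i) p`_m * q`_(i - m).
Proof.
move=> p0 q0; rewrite coefM; case: i => [|i].
  by rewrite big_ord1 p0 mul0r big_geq.
rewrite -(big_mkord predT (fun m => p`_m * q`_(i.+1 - m))).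
by rewrite big_ltn // p0 mul0r add0r big_nat_recr //= subnn q0 mulr0 addr0.
Qed.

Lemma represents_mul {N p q a b} i : represents N p a -> represents N q b ->
  (i < N)%N -> (p * q)`_i = \sum_(1 <= m < i) a m * b (i - m)%N.
Proof.
move=> pa qb iN; have N0 : (0 < N)%N := leq_ltn_trans (leq0n i) iN.
rewrite coef_mul_conv ?pa ?qb //.
apply: eq_big_nat => m /andP[m1 mi]; rewrite pa ?qb //.
- by rewrite !gtn_eqF // subn_gt0.
- by rewrite (leq_ltn_trans _ iN) // leq_subr.
- exact: ltn_trans iN.
Qed.

Definition sigma_ser N s : {poly int} :=
  \poly_(i < N) if i == 0%N then 0 else sigma s i.
Definition sigma_ser2 N s : {poly int} := sigma_ser N s \Po 'X^2.
Definition tilde_ser N s := sigma_ser N s - (2 ^ s.+1)%:R * sigma_ser2 N s.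
Definition hat_ser N := sigma_ser N 1 - 2 * sigma_ser2 N 1.

Lemma represents_sigma N s : represents N (sigma_ser N s) (sigma s).
Proof. by move=> i iN; rewrite coef_poly iN. Qed.

Lemma represents_tilde N s : represents N (tilde_ser N s) (sigma_tilde s).
Proof.
move=> i iN; rewrite coefB coef_natl represents_sigma //.
rewrite (represents_comp (represents_sigma N s)) //.
by case: posnP => [_|i0]; rewrite ?sigma_tildeE ?natrX //; ring.
Qed.

Lemma represents_hat N : represents N (hat_ser N) (sigma_hat 1).
Proof.
move=> i iN; rewrite coefB coef_natl represents_sigma //.
rewrite (represents_comp (represents_sigma N 1)) //.
by case: posnP => [_|i0]; rewrite ?sigma_hatE //; ring.
Qed.

Definition coef_lin := (coefD, coefN, coef_natl, coef_theta).

(** * The convolution formulas as congruences between series *)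

Lemma vanish_sigma1_sigma1 N : vanish N
  (12 * (sigma_ser N 1 * sigma_ser N 1) - 5 * sigma_ser N 3 - sigma_ser N 1
   + 6 * theta (sigma_ser N 1)).
Proof.
have := represents_sigma N 3; have := represents_sigma N 1.
move: (sigma_ser N 1) (sigma_ser N 3) => s1 s3 hs1 hs3 i iN.
rewrite !coef_lin (represents_mul i hs1 hs1) // hs1 // hs3 //.
case: posnP => [->|i0]; first by rewrite big_geq.
by rewrite conv_sigma1_sigma1 //; ring.
Qed.

Lemma vanish_sigma1_sigma3 N : vanish N
  (240 * (sigma_ser N 1 * sigma_ser N 3) - 21 * sigma_ser N 5
   - 10 * sigma_ser N 3 + sigma_ser N 1 + 30 * theta (sigma_ser N 3)).
Proof.
have := represents_sigma N 5; have := represents_sigma N 3.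
have := represents_sigma N 1.
move: (sigma_ser N 1) (sigma_ser N 3) (sigma_ser N 5).
move=> s1 s3 s5 hs1 hs3 hs5 i iN.
rewrite !coef_lin (represents_mul i hs1 hs3) // hs1 // hs3 // hs5 //.
case: posnP => [->|i0]; first by rewrite big_geq.
by rewrite conv_sigma1_sigma3 //; ring.
Qed.

Lemma vanish_tilde1_tilde1 N : vanish N
  (4 * (tilde_ser N 1 * tilde_ser N 1) + tilde_ser N 3 + tilde_ser N 1
   - 2 * theta (tilde_ser N 1)).
Proof.
have := represents_tilde N 3; have := represents_tilde N 1.
move: (tilde_ser N 1) (tilde_ser N 3) => t1 t3 ht1 ht3 i iN.
rewrite !coef_lin (represents_mul i ht1 ht1) // ht1 // ht3 //.
case: posnP => [->|i0]; first by rewrite big_geq.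
by rewrite conv_tilde1_tilde1 //; ring.
Qed.

Lemma vanish_tilde1_tilde3 N : vanish N
  (16 * (tilde_ser N 1 * tilde_ser N 3) + 2 * tilde_ser N 3 + tilde_ser N 5
   - tilde_ser N 1 - 2 * theta (tilde_ser N 3)).
Proof.
have := represents_tilde N 5; have := represents_tilde N 3.
have := represents_tilde N 1.
move: (tilde_ser N 1) (tilde_ser N 3) (tilde_ser N 5).
move=> t1 t3 t5 ht1 ht3 ht5 i iN.
rewrite !coef_lin (represents_mul i ht1 ht3) // ht1 // ht3 // ht5 //.
case: posnP => [->|i0]; first by rewrite big_geq.
by rewrite conv_tilde1_tilde3 //; ring.
Qed.

(** Substituting [X^2] for [X] doubles [theta], whence the halved coefficient
    of the derivative here and in the next lemma. *)
Lemma vanish_sigma1_sigma1_sq N : vanish N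
  (12 * (sigma_ser2 N 1 * sigma_ser2 N 1) - 5 * sigma_ser2 N 3 - sigma_ser2 N 1
   + 3 * theta (sigma_ser2 N 1)).
Proof.
have := vanish_comp (vanish_sigma1_sigma1 N).
congr (vanish N _); rewrite /sigma_ser2 theta_comp.
by rewrite !(comp_polyD, comp_polyB, comp_natl) comp_polyM; ring.
Qed.

Lemma vanish_sigma1_sigma3_sq N : vanish N
  (240 * (sigma_ser2 N 1 * sigma_ser2 N 3) - 21 * sigma_ser2 N 5
   - 10 * sigma_ser2 N 3 + sigma_ser2 N 1 + 15 * theta (sigma_ser2 N 3)).
Proof.
have := vanish_comp (vanish_sigma1_sigma3 N).
congr (vanish N _); rewrite /sigma_ser2 theta_comp.
by rewrite !(comp_polyD, comp_polyB, comp_natl) comp_polyM; ring.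
Qed.

Lemma theta_tilde N s : theta (tilde_ser N s)
  = theta (sigma_ser N s) - (2 ^ s.+1)%:R * theta (sigma_ser2 N s).
Proof. by rewrite thetaD thetaN theta_natl. Qed.

Lemma theta_hat N :
  theta (hat_ser N) = theta (sigma_ser N 1) - 2 * theta (sigma_ser2 N 1).
Proof. by rewrite thetaD thetaN theta_natl. Qed.

(** * The products with the hat series *)

(** With [t = s - 4 u] and [h = s - 2 u] the multipliers come from
    [48 h t = 9 (4 t^2) + 12 s^2 - 16 (12 u^2)]. *)
Lemma vanish_hat_tilde1 N : vanish N
  (24 * (hat_ser N * tilde_ser N 1) + 2 * tilde_ser N 3 - 6 * theta (hat_ser N)
   + 3 * hat_ser N + tilde_ser N 1).
Proof.
apply: (vanish_cancel 1).
have T := vanishM 9 (vanish_tilde1_tilde1 N).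
have L := vanish_sigma1_sigma1 N.
have L' := vanishM (-16) (vanish_sigma1_sigma1_sq N).
have := vanishD (vanishD T L) L'.
by congr (vanish N _); rewrite theta_tilde theta_hat /tilde_ser /hat_ser; ring.
Qed.

(** Here [24 h^2 = 3 (4 t^2) + 12 s^2 - 8 (12 u^2)], and the derivatives
    cancel: in the language of modular forms, [1 + 24 h] is a holomorphic form
    of weight 2 and level 2, and its square is an Eisenstein series. *)
Lemma vanish_hat_hat N : vanish N
  (12 * (hat_ser N * hat_ser N) + hat_ser N - sigma_ser N 3
   - 4 * sigma_ser2 N 3).
Proof.
apply: (vanish_cancel 1).
have T := vanishM 3 (vanish_tilde1_tilde1 N).
have L := vanish_sigma1_sigma1 N.
have L' := vanishM (-8) (vanish_sigma1_sigma1_sq N).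
have := vanishD (vanishD T L) L'.
by congr (vanish N _); rewrite theta_tilde /tilde_ser /hat_ser; ring.
Qed.

(** Differentiate [vanish_hat_hat]: this gives [(24 h + 1) theta h] in terms
    of [theta s3] and [theta u3].  Now eliminate [theta h] by
    [vanish_hat_tilde1], then the products [h^2 t1] and [h^2] that appear by
    [vanish_hat_hat] itself, and [theta s3], [theta u3] by the level 1
    formulas.  All the products [s1 s3], [s1 u3], [u1 s3] and [u1 u3] that
    remain combine into [h (s3 - 4 u3)]. *)
Lemma vanish_hat_weight4 N : vanish N
  (720 * (hat_ser N * (sigma_ser N 3 - 4 * sigma_ser2 N 3))
   + 30 * (sigma_ser N 3 - 4 * sigma_ser2 N 3)
   - 21 * (sigma_ser N 5 + 8 * sigma_ser2 N 5) - 9 * hat_ser N).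
Proof.
have DE := vanishM 30 (vanish_theta (vanish_hat_hat N)).
have II := vanishM (5 * (24 * hat_ser N + 1)) (vanish_hat_tilde1 N).
have E := vanishM (- 5 * (48 * tilde_ser N 1 + 6)) (vanish_hat_hat N).
have L := vanish_sigma1_sigma3 N.
have L' := vanishM 8 (vanish_sigma1_sigma3_sq N).
have := vanishD (vanishD (vanishD DE II) (vanishD E L)) L'.
congr (vanish N _); rewrite /tilde_ser /hat_ser.
by rewrite !(thetaD, thetaN, theta_natl, thetaM); ring.
Qed.

Lemma vanish_hat_tilde3 N : vanish N
  (48 * (hat_ser N * tilde_ser N 3) + 2 * tilde_ser N 3 + tilde_ser N 5
   - 3 * hat_ser N).
Proof.
have L := vanish_sigma1_sigma3 N.
have T := vanishM 15 (vanish_tilde1_tilde3 N).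
have L' := vanishM (-32) (vanish_sigma1_sigma3_sq N).
(* The quadratic part of the sum of T, L and L' is 480 h (s3 - 8 u3); the
   target has t3 = s3 - 16 u3, and 30 * 48 (s3 - 16 u3) is
   9 * 480 (s3 - 8 u3) - 4 * 720 (s3 - 4 u3). *)
apply: (vanish_cancel 29).
have G3 := vanishM 9 (vanishD (vanishD T L) L').
have G2 := vanishM (-4) (vanish_hat_weight4 N).
have := vanishD G3 G2.
by congr (vanish N _); rewrite theta_tilde /tilde_ser /hat_ser; ring.
Qed.

Lemma conv_hat1_tilde1 n : (0 < n)%N ->
  24 * (\sum_(1 <= m < n) sigma_hat 1 m * sigma_tilde 1 (n - m))
  = - 2 * sigma_tilde 3 n + (6 * n%:Z - 3) * sigma_hat 1 n - sigma_tilde 1 n.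
Proof.
move=> n0; have := vanish_hat_tilde1 n.+1 n (ltnSn n).
have := represents_tilde n.+1 3; have := represents_tilde n.+1 1.
have := represents_hat n.+1.
move: (hat_ser _) (tilde_ser _ 1) (tilde_ser _ 3) => h t1 t3 hh ht1 ht3.
rewrite !coef_lin (represents_mul n hh ht1) // hh // ht1 // ht3 // gtn_eqF //.
by move=> E; apply: (eq_from_multiple 1 E); ring.
Qed.

Lemma conv_hat1_tilde3 n : (0 < n)%N ->
  48 * (\sum_(1 <= m < n) sigma_hat 1 m * sigma_tilde 3 (n - m))
  = 3 * sigma_hat 1 n - 2 * sigma_tilde 3 n - sigma_tilde 5 n.
Proof.
move=> n0; have := vanish_hat_tilde3 n.+1 n (ltnSn n).
have := represents_tilde n.+1 5; have := represents_tilde n.+1 3.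
have := represents_hat n.+1.
move: (hat_ser _) (tilde_ser _ 3) (tilde_ser _ 5) => h t3 t5 hh ht3 ht5.
rewrite !coef_lin (represents_mul n hh ht3) // hh // ht3 // ht5 // gtn_eqF //.
by move=> E; apply: (eq_from_multiple 1 E); ring.
Qed.

Theorem theorem4p1 (n : nat) (hn : (0 < n)%N) :
  [/\ 4 * (\sum_(1 <= m < n) sigma_tilde 1 m * sigma_tilde 1 (n - m)%N)
        = - sigma_tilde 3 n + (2 * n%:Z - 1) * sigma_tilde 1 n,
      24 * (\sum_(1 <= m < n) sigma_hat 1 m * sigma_tilde 1 (n - m)%N)
        = - 2 * sigma_tilde 3 n + (6 * n%:Z - 3) * sigma_hat 1 n
          - sigma_tilde 1 n
    & 16 * (\sum_(1 <= m < n)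
              (sigma_tilde 1 m - 3 * sigma_hat 1 m) * sigma_tilde 3 (n - m)%N)
        = 2 * n%:Z * sigma_tilde 3 n + sigma_tilde 1 n - 3 * sigma_hat 1 n].
Proof.
split; first exact: conv_tilde1_tilde1.
  exact: conv_hat1_tilde1.
under eq_bigr do rewrite mulrBl -mulrA.
rewrite sumrB -mulr_sumr mulrBr conv_tilde1_tilde3 // mulrA.
by rewrite conv_hat1_tilde3 //; ring.
Qed.
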